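(* For every integer $n\geq 3$, $$d(\mathbb{M}^n_Z)=\binom{n+2}{\lfloor (n+2)/2\rfloor}.$$
   Context: A Minkowski space $\mathbb{M}^n$ is an $n$-dimensional real normed space $(\mathbb{R}^n,\|\cdot\|)$. A Steiner tree of a finite set $N\subset\mathbb{M}^n$ is a finite tree $T$ whose vertex set $V(T)$ is a finite set of points of $\mathbb{M}^n$ with $N\subseteq V(T)$; its length is $\ell(T)=\sum_{xy\in E(T)}\|x-y\|$. The points of $N$ are called nodes or given points, the points of $V(T)\setminus N$ are called Steiner points. A Steiner minimal tree (SMT) of $N$ is a Steiner tree of $N$ of minimum length. $d(\mathbb{M}^n)$ denotes the maximum degree of a given point in an SMT, the maximum being taken over all SMTs (of all finite sets $N$) in $\mathbb{M}^n$. $\mathbb{M}^n_Z$ denotes $\mathbb{R}^n$ with the norm whose unit ball is $\operatorname{conv}([0,1]^n\cup[-1,0]^n)$. *)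

(* Defs.v *)
From HB Require Import structures.
From mathcomp Require Import all_boot all_order all_algebra finmap.
From mathcomp Require Import interval_inference boolp classical_sets reals convex topology.
From mathcomp Require Import normedtype.
From mathcomp Require Import ring lra.

Set Implicit Arguments.
Unset Strict Implicit.
Unset Printing Implicit Defensive.

Import Order.TTheory GRing.Theory Num.Theory.

Local Open Scope classical_set_scope.
Local Open Scope ring_scope.

Section Graphs.
Context {T : finType} (e : rel T).

(* [ucycle] accepts the closed walk [:: x; y] along a single edge, which is
   not a cycle of the simple graph e; cycles have at least 3 vertices. *)
Definition acyclic := forall c : seq T, ucycle e c -> (size c <= 2)%N.

Definition is_tree :=
  [/\ symmetric e, irreflexive e, (0 < #|T|)%N,
      forall x y, connect e x y & acyclic].

Definition degree (x : T) : nat := #|[set y | e x y]%SET|.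

End Graphs.

Section SteinerTrees.
Context {R : realType} (V : normedModType R).

Record ptree := PTree {
  vertices : {fset V};
  edge : rel vertices;
  edge_tree : is_tree edge }.

(* The double sum ranges over ordered pairs and counts every edge twice. *)
Definition tree_length (T : ptree) : R :=
  (\sum_(x : vertices T) \sum_(y : vertices T | edge x y)
     `|fsval x - fsval y|) / 2.

Definition steiner_tree (N : {fset V}) (T : ptree) := (N `<=` vertices T)%fset.

Definition SMT (N : {fset V}) (T : ptree) :=
  steiner_tree N T /\
  forall T' : ptree, steiner_tree N T' -> tree_length T <= tree_length T'.

Definition given_degrees : set nat :=
  [set k | exists (N : {fset V}) (T : ptree) (x : vertices T),
     [/\ SMT N T, fsval x \in N & degree (@edge T) x = k]].

(* d(V) = k, including the fact that the maximum exists. *)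
Definition max_given_degree (k : nat) :=
  given_degrees k /\ forall m, given_degrees m -> (m <= k)%N.

End SteinerTrees.

Definition convex_hull {R : realType} {E : lmodType R} (A : set E) : set E :=
  smallest (fun B : set E => convex_set B) A.

Definition gauge {R : realType} {E : lmodType R} (B : set E) (x : E) : R :=
  inf [set r | 0 < r /\ B (r^-1 *: x)].

Section ZonotopeNorm.
Context (R : realType) (n : nat).
Implicit Types x y : 'rV[R]_n.

Definition Zball : set 'rV[R]_n :=
  convex_hull ([set x : 'rV[R]_n | forall i, 0 <= x 0 i <= 1] `|`
               [set x : 'rV[R]_n | forall i, -1 <= x 0 i <= 0]).

Let P (r : R) : set 'rV[R]_n := [set x : 'rV[R]_n |
  (forall i, `|x 0 i| <= r) /\ forall i j, x 0 i - x 0 j <= r].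

Let convP : convex_set (P 1).
Proof.
apply/convex_setW => x y; rewrite !inE => -[x1 x2] [y1 y2] l l0 l1.
have -> : (conv l (x : convex_lmodType _) y : 'rV[R]_n) =
  l%:num *: x + (1 - l%:num) *: y by [].
move: (l%:num) l0 l1 => t t0 t1; rewrite inE; split=> [i|i j].
  have := x1 i; have := y1 i; rewrite !ler_norml => /andP[? ?] /andP[? ?].
  by rewrite !mxE; apply/andP; split; nra.
have := x2 i j; have := y2 i j; rewrite !mxE => ? ?.
nra.
Qed.

Let ZballE : Zball = P 1.
Proof.
apply/seteqP; split.
  apply: smallest_sub => // x [] /= x01; split=> [i|i j].
  - by have /andP[? ?] := x01 i; rewrite ler_norml; apply/andP; split; lra.
  - by have /andP[? ?] := x01 i; have /andP[? ?] := x01 j; lra.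
  - by have /andP[? ?] := x01 i; rewrite ler_norml; apply/andP; split; lra.
  - by have /andP[? ?] := x01 i; have /andP[? ?] := x01 j; lra.
move=> x [x1 x2] B [cB sB].
have x1' i : -1 <= x 0 i <= 1 by rewrite -ler_norml.
pose a : R := \big[Num.max/0]_i x 0 i.
have a0 : 0 <= a by apply: bigmax_ge_id.
have xa i : x 0 i <= a by apply: le_bigmax.
have aP c : 0 <= c -> (forall i, x 0 i <= c) -> a <= c.
  by move=> c0 xc; apply/bigmax_leP.
have a1 : a <= 1 by apply: aP => // i; have /andP[] := x1' i.
have [a00|an0] := eqVneq a 0.
  apply: sB; right => i /=; have := xa i; rewrite a00.
  by have /andP[-> _ ->] := x1' i.
have [a11|an1] := eqVneq a 1.
  apply: sB; left => i /=; have /andP[_ ->] := x1' i; rewrite andbT.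
  have : a <= 1 + x 0 i.
    apply: aP => [|j]; first by have /andP[] := x1' i; lra.
    by have := x2 j i; lra.
  by rewrite a11; lra.
have ap : 0 < a by rewrite lt_neqAle eq_sym an0.
have ap1 : 0 < 1 - a by rewrite subr_gt0 lt_neqAle an1.
pose u : 'rV[R]_n := \row_i (Num.max (x 0 i) 0 / a).
pose v : 'rV[R]_n := \row_i (Num.min (x 0 i) 0 / (1 - a)).
have Bu : B u.
  apply: sB; left => i /=; rewrite mxE ler_pdivlMr// ler_pdivrMr// mul0r mul1r.
  by rewrite le_max lexx orbT ge_max xa a0.
have Bv : B v.
  apply: sB; right => i /=; rewrite mxE ler_pdivlMr// ler_pdivrMr// mul0r.
  rewrite mulN1r opprB le_min ge_min lexx orbT andbT.
  have h : a <= 1 + Num.min 0 (x 0 i).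
    case: (leP 0 (x 0 i)) => xi0; rewrite ?addr0//.
    apply: aP => [|j]; first by have /andP[] := x1' i; lra.
    by have := x2 j i; lra.
  have := h; rewrite minC => h'; have : Num.min (x 0 i) 0 <= x 0 i.
    by rewrite ge_min lexx.
  by move=> ?; rewrite !(andbT, subr_le0) a1 ?andbT; lra.
have ai : 0 <= a <= 1 by rewrite a0 a1.
have := cB u v (Itv01 a0 a1); rewrite !inE => /(_ Bu Bv).
congr B; apply/rowP => i.
have -> : (conv (Itv01 a0 a1) (u : convex_lmodType _) v : 'rV[R]_n) =
  a *: u + (1 - a) *: v by [].
rewrite !mxE !mulrA ![_ * _ / _]mulrAC !divff ?gt_eqF// !mul1r.
by case: (leP 0 (x 0 i)) => xi0; rewrite ?addr0 ?add0r.
Qed.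

Let gaugeP x : [set r | 0 < r /\ Zball (r^-1 *: x)] = [set r | 0 < r /\ P r x].
Proof.
apply/seteqP; split=> r /= [r0]; rewrite ZballE => -[h1 h2]; split=> //.
  split=> [i|i j].
    have := h1 i; rewrite mxE normrM gtr0_norm ?invr_gt0//.
    by rewrite mulrC ler_pdivrMr// mul1r.
  have := h2 i j; rewrite !mxE -mulrBr.
  by rewrite mulrC ler_pdivrMr// mul1r.
split=> [i|i j].
  by rewrite mxE normrM gtr0_norm ?invr_gt0// mulrC ler_pdivrMr// mul1r.
by rewrite !mxE -mulrBr mulrC ler_pdivrMr// mul1r.
Qed.

Definition Znorm x : R := gauge Zball x.

Let hasinf x : has_inf [set r : R | 0 < r /\ P r x].
Proof.
split; last by exists 0 => r /= [/ltW].
pose m : R := \sum_i `|x 0 i|.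
have xm i : `|x 0 i| <= m.
  by rewrite /m (bigD1 i)//= lerDl; apply: sumr_ge0.
have m0 : 0 <= m by apply: sumr_ge0.
exists (m + m + 1) => /=; split; first by lra.
split=> [i|i j]; first by have := xm i; lra.
have := xm i; have := xm j; rewrite !ler_norml => /andP[? ?] /andP[? ?]; lra.
Qed.

Let Znorm_ge0 x : 0 <= Znorm x.
Proof.
rewrite /Znorm /gauge gaugeP; apply: lb_le_inf => [|r /= [/ltW]//].
by have [] := hasinf x.
Qed.

Let ZnormP x : P (Znorm x) x.
Proof.
have H := hasinf x; rewrite /Znorm /gauge gaugeP; split=> [i|i j].
  by apply: lb_le_inf; [case: H|move=> r /= [_ []]].
by apply: lb_le_inf; [case: H|move=> r /= [_ []]].
Qed.

Let Znorm_le x r : 0 <= r -> P r x -> Znorm x <= r.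
Proof.
move=> r0 [h1 h2]; apply/ler_addgt0Pl => e e0.
rewrite /Znorm /gauge gaugeP; apply: ge_inf; first by have [] := hasinf x.
split; first by lra.
by split=> [i|i j]; [have := h1 i|have := h2 i j]; lra.
Qed.

Lemma Znorm_ball : [set x | Znorm x <= 1] = Zball.
Proof.
rewrite ZballE; apply/seteqP; split=> x /= h; last exact: Znorm_le.
by have [h1 h2] := ZnormP x; split=> [i|i j]; exact: le_trans h.
Qed.

Let ler_ZnormD x y : Znorm (x + y) <= Znorm x + Znorm y.
Proof.
have [x1 x2] := ZnormP x; have [y1 y2] := ZnormP y.
apply: Znorm_le; first exact: addr_ge0.
split=> [i|i j]; rewrite !mxE.
  by rewrite (le_trans (ler_normD _ _))// lerD.
by have := x2 i j; have := y2 i j; lra.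
Qed.

Let ZnormZ_le (l : R) x : Znorm (l *: x) <= `|l| * Znorm x.
Proof.
have [x1 x2] := ZnormP x; apply: Znorm_le; first exact: mulr_ge0.
split=> [i|i j]; rewrite !mxE; first by rewrite normrM ler_wpM2l.
rewrite -mulrBr; have [l0|l0] := ger0P l; first by rewrite ler_wpM2l.
by rewrite -mulrNN opprB ler_wpM2l// oppr_ge0 ltW.
Qed.

Let ZnormZ (l : R) x : Znorm (l *: x) = `|l| * Znorm x.
Proof.
apply/eqP; rewrite eq_le ZnormZ_le /=; have [->|l0] := eqVneq l 0.
  by rewrite normr0 mul0r.
have := ZnormZ_le l^-1 (l *: x); rewrite scalerA mulVf// scale1r normfV.
by rewrite mulrC ler_pdivlMr ?normr_gt0// mulrC.
Qed.

Let Znorm0_eq0 x : Znorm x = 0 -> x = 0.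
Proof.
move=> x0; have [x1 _] := ZnormP x; apply/rowP => i; rewrite mxE.
by apply/normr0_eq0/eqP; rewrite eq_le normr_ge0 -x0 x1.
Qed.

(* A copy of 'rV[R]_n: the canonical norm on 'rV[R]_n is the sup norm. *)
Definition MZ := 'rV[R]_n.

HB.instance Definition _ := GRing.Lmodule.on MZ.
HB.instance Definition _ :=
  Lmodule_isNormed.Build R MZ ler_ZnormD ZnormZ Znorm0_eq0.

Lemma MZ_unit_ball : [set x : MZ | `|x| <= 1] = Zball.
Proof. exact: Znorm_ball. Qed.

End ZonotopeNorm.

(* Main.v *)
Require Import Defs.
From mathcomp Require Import interval_inference classical_sets convex.
From mathcomp Require Import all_boot all_order all_algebra reals normedtype.
From mathcomp Require Import finmap lra zify.

(* Adding a coordinate equal to 0 and writing K for the set of n + 1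
   coordinates, the norm of z is max z - min z, and vectors are functions on K
   modulo constants.

   Upper bound: to a neighbour y of x in a minimal tree assign the set S_y of
   the coordinates where y - x is maximal. If S_y = S_y' for y <> y', or if
   S_y1 < S_y2 < S_y3 is a chain, then new points near x, displaced by small
   multiples of indicators, give a shorter tree. So the degree of x is at most
   the size of a family of subsets of K without 3-chains; adjoining one further
   element to the minimal members turns it into an antichain in a set of n + 2
   elements, and Sperner's theorem applies.

   Lower bound: the star from 0 to the indicators chi_S of the sets S in two
   adjacent middle levels has length the number m of these sets. It is minimal
   by calibration: for any tree rooted at 0 one finds functionals
   phi_S = e_a - e_b with a in S, b not in S, such that the sum of phi_S over
   the points chi_S beyond an edge is 0 or some e_a - e_b, hence of norm at most
   1 for every edge; then m = sum_S phi_S(chi_S) is at most the length of the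
   tree. *)

Set Implicit Arguments.
Unset Strict Implicit.
Unset Printing Implicit Defensive.

Import Order.TTheory GRing.Theory Num.Theory.

Local Open Scope ring_scope.

(** * Families of sets without 3-chains *)

(** Below the middle the ratio (m - j) / (j + 1) of consecutive binomials is at least 1; symmetry
    covers the upper half. *)
Lemma leq_bin_half m k : ('C(m, k) <= 'C(m, m./2))%N.
Proof.
have up j : (j < m./2)%N -> ('C(m, j) <= 'C(m, j.+1))%N.
  move=> jm; have jm2 : (j < m - j)%N by lia.
  have c0 : (0 < 'C(m, j))%N by rewrite bin_gt0; lia.
  by rewrite -(leq_pmul2l (ltn0Sn j)) mul_bin_left leq_pmul2r.
have low d : (d <= m./2)%N -> ('C(m, m./2 - d) <= 'C(m, m./2))%N.
  elim: d => [|d IH] dm; first by rewrite subn0.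
  apply: leq_trans (IH (ltnW dm)).
  have -> : (m./2 - d = (m./2 - d.+1).+1)%N by lia.
  by apply: up; lia.
have [km|] := leqP k m./2; first by rewrite -(subKn km) low ?leq_subr.
have [km|? _] := leqP k m; last by rewrite bin_small.
move=> mk; rewrite -bin_sub//.
have -> : (m - k = m./2 - (m./2 - (m - k)))%N by lia.
by apply: low; lia.
Qed.

Section Sperner.
Variable T : finType.
Implicit Types (A B C U : {set T}) (F : {set {set T}}).

Definition antichain F := {in F &, forall A B, A \subset B -> A = B}.

(* Averaging over the elements x of U the inequality for the members avoiding
   x, seen as subsets of U minus x. *)
Lemma LYM F U : antichain F -> {in F, forall A, A \subset U} ->
  \sum_(A in F) ('C(#|U|, #|A|)%:R)^-1 <= 1 :> rat.
Proof.
have [k] := ubnP #|U|; elim: k F U => // k IH F U /ltnSE Uk aF FU.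
have [UF|UF] := boolP (U \in F).
  rewrite (big_pred1 U) ?binn ?invr1// => A /=.
  by apply/idP/eqP => [AF|->//]; apply: aF => //; exact: FU.
have [U0|U0] := posnP #|U|.
  rewrite big1// => A AF; case/negP: UF.
  suff <- : A = U by [].
  by apply/eqP; rewrite eqEcard FU// U0.
have cU : 0 < #|U|%:R :> rat by rewrite ltr0n.
rewrite -(ler_pM2l cU) mulr1.
have cA A : A \in F -> (#|A| < #|U|)%N.
  move=> AF; apply: proper_card; rewrite properEneq FU// andbT.
  by apply: contraNneq UF => <-.
(* A member of size a avoids u - a of the u elements of [U], and (u - a) / C(u - 1, a) = u / C(u,
   a); summing over the avoided [x] recovers the left side. *)
rewrite mulr_sumr [leLHS](_ : _ =
   \sum_(x in U) \sum_(A in [set A in F | x \notin A])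
     ('C(#|U :\ x|, #|A|)%:R)^-1).
  apply: le_trans (_ : \sum_(x in U) 1 <= _); last by rewrite sumr_const.
  apply: ler_sum => x xU; apply: IH.
  - by apply: leq_trans Uk; rewrite (cardsD1 x U) xU.
  - by move=> A B; rewrite !inE => /andP[? _] /andP[? _]; apply: aF.
  - by move=> A; rewrite !inE => /andP[AF xA]; rewrite subsetD1 FU.
under [RHS]eq_bigr => x xU.
  under eq_bigl => A do rewrite inE.
  over.
rewrite (exchange_big_dep (mem F)) /=; last by move=> x A _ /andP[].
apply: eq_bigr => A AF.
rewrite (eq_bigr (fun=> ('C(#|U|.-1, #|A|)%:R)^-1)); last first.
  by move=> x /and3P[xU _ _]; rewrite (cardsD1 x U) xU.
rewrite (eq_bigl (mem (U :\: A))); last first.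
  by move=> x; rewrite /= !inE AF andbC.
rewrite sumr_const cardsD (setIidPr (FU A AF)).
have := cA _ AF; case: #|U| cU => //= u cU lt.
have := mul_bin_down u.+1 #|A|.
move=> /(congr1 (fun n => n%:R : rat)); rewrite !natrM => E.
have b0 : 'C(u.+1, #|A|)%:R != 0 :> rat by rewrite pnatr_eq0 -lt0n bin_gt0 ltnW.
have b1 : 'C(u, #|A|)%:R != 0 :> rat by rewrite pnatr_eq0 -lt0n bin_gt0.
by rewrite -[RHS]mulr_natl; apply/eqP; rewrite eqr_div// E.
Qed.

Lemma sperner F : antichain F -> (#|F| <= 'C(#|T|, #|T|./2))%N.
Proof.
move=> aF; have lym := @LYM F [set: T] aF (fun A _ => subsetT A).
have c0 : 0 < 'C(#|T|, #|T|./2)%:R :> rat.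
  by rewrite ltr0n bin_gt0; lia.
rewrite -(ler_nat rat) -[leRHS]mul1r -ler_pdivrMr//; apply: le_trans lym.
rewrite mulr_natl -sumr_const; apply: ler_sum => A _.
rewrite cardsT lef_pV2 ?posrE ?ltr0n ?bin_gt0 ?max_card//.
  by rewrite ler_nat leq_bin_half.
by lia.
Qed.

End Sperner.

(* Adjoining a new element to the minimal members turns F into an
   antichain. *)
Lemma no_3chain_card (T : finType) (F : {set {set T}}) :
  {in F & &, forall A B C : {set T}, A \proper B -> ~~ (B \proper C)} ->
  (#|F| <= 'C(#|T|.+1, (#|T|.+1)./2))%N.
Proof.
move=> noF; pose isMin (A : {set T}) := [forall B in F, ~~ (B \proper A)].
pose h (A : {set T}) : {set option T} := (Some @: A) :|: (if isMin A then [set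
  None] else set0).
have Some_inj : injective (@Some T) by move=> ? ? [].
have hS A x : (Some x \in h A) = (x \in A).
  by rewrite !inE mem_imset//; case: ifP; rewrite !inE orbF.
have hN A : (None \in h A) = isMin A.
  rewrite !inE; case: imsetP => [[]//|_] /=; by case: ifP; rewrite inE.
have h_sub A B : h A \subset h B -> A \subset B /\ (isMin A -> isMin B).
  move=> /subsetP s; split; last by rewrite -!hN; apply: s.
  by apply/subsetP => x; rewrite -!hS; apply: s.
have h_inj : injective h.
  move=> A B E; apply/eqP; rewrite eqEsubset.
  by rewrite (proj1 (h_sub A B _)) ?E// (proj1 (h_sub B A _)) ?E.
rewrite -(card_imset _ h_inj) -card_option; apply: sperner.
move=> _ _ /imsetP[A AF ->] /imsetP[B BF ->] /h_sub[AB mAB].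
congr h; apply/eqP/contraT => neAB.
have pAB : A \proper B by rewrite properEneq neAB.
(* A member strictly below [A] would form a 3-chain with [A] and [B]. So [A] is minimal, and
   [h A \subset h B] makes [B] minimal too, against [A \proper B]. *)
have mA : isMin A.
  apply/forall_inP => C CF; apply/negP => CA.
  by have /negP := noF _ _ _ CF AF BF CA.
by have /forall_inP/(_ A AF) := mAB mA; rewrite pAB.
Qed.

(** * Connected graphs and spanning trees *)

Lemma connect_ind (X : finType) (e : rel X) (P : X -> Prop) x y :
  (forall u v, e u v -> P u -> P v) -> connect e x y -> P x -> P y.
Proof.
move=> cl /connectP[p]; elim: p x => [|z p IH] x /=; first by move=> _ ->.
by move=> /andP[xz zp] yE /(cl _ _ xz); apply: IH.
Qed.

(** Induction that builds the vertex set from [r], one adjacent vertex at a time: a set containing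
    [r] that no edge leaves is already everything. *)
Lemma connected_grow (X : finType) (e : rel X) (r : X) (P : {set X} -> Prop) :
  (forall x, connect e r x) -> P [set r] ->
  (forall W u v, P W -> r \in W -> u \in W -> v \notin W -> e u v ->
     P (v |: W)) ->
  P [set: X].
Proof.
move=> cr Pr Pstep.
suff H k W : (#|~: W| <= k)%N -> r \in W -> P W -> P [set: X].
  by apply: (H _ _ (leqnn _) _ Pr); rewrite inE.
elim: k W => [|k IH] W.
  by rewrite leqn0 cards_eq0 -subset0 subCset setC0 subTset => /eqP->.
move=> Wk rW PW.
have [/eqP <-//|WT] := boolP (W == [set: X]).
have [/exists_inP[u uW /exists_inP[v vW uv]]|] :=
  boolP [exists u in W, [exists v in ~: W, e u v]].
  rewrite inE in vW; apply: (IH (v |: W)); first 2 last.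
  - exact: Pstep PW rW uW vW uv.
  - rewrite -ltnS; apply: leq_trans Wk; apply: proper_card.
    rewrite properC properEneq subsetUr andbT.
    by apply: contraNneq vW => ->; rewrite setU11.
  - by rewrite in_setU rW orbT.
rewrite negb_exists_in => /forall_inP no; case/negP: WT.
apply/eqP/setP => x; rewrite inE.
apply: (connect_ind (P := fun x => x \in W)) (cr x) rW => u v uv uW.
apply: contraT => vW; have /existsP[] := no u uW.
by exists v; rewrite inE vW.
Qed.

(* A connected spanning subgraph with the fewest edges has no cycle. *)
Lemma spanning_tree (X : finType) (e : rel X) :
  symmetric e -> irreflexive e -> (0 < #|X|)%N ->
  (forall x y, connect e x y) ->
  exists2 t : rel X, is_tree t & subrel t e.
Proof.
move=> se ie X0 ce.
pose t (E : {set X * X}) : rel X := [rel x y | (x, y) \in E].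
pose good E := [&& [forall x, forall y, t E x y ==> t E y x],
  [forall x, forall y, t E x y ==> e x y] &
  [forall x, forall y, connect (t E) x y]].
have goodP E : reflect [/\ symmetric (t E), subrel (t E) e &
    forall x y, connect (t E) x y] (good E).
  apply: (iffP and3P) => -[s u c]; split.
  - move=> x y; apply/idP/idP.
      exact/implyP/(forallP (forallP s x) y).
    exact/implyP/(forallP (forallP s y) x).
  - by move=> x y; apply/implyP/(forallP (forallP u x) y).
  - by move=> x y; apply/(forallP (forallP c x) y).
  - by apply/forallP => x; apply/forallP => y; rewrite s implybb.
  - by apply/forallP => x; apply/forallP => y; apply/implyP/u.
  - by apply/forallP => x; apply/forallP => y; apply/c.
pose E0 := [set q : X * X | e q.1 q.2].
have tE0 : t E0 =2 e by move=> x y; rewrite /t /= inE.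
have g0 : good E0.
  apply/goodP; split=> [x y|x y|x y]; rewrite ?tE0//.
  by rewrite (eq_connect tE0).
have [E /goodP[sE uE cE] minE] := arg_minnP (fun E : {set X * X} => #|E|) g0.
exists (t E) => //; split=> //.
  by move=> x; apply/negP => /uE; rewrite ie.
move=> c /andP[]; case: c => // a [//|h [//|b' p]].
set q := b' :: p => cy un; exfalso.
pose b := last h q.
have /andP[aq uq] : (a \notin h :: q) && uniq (h :: q) by [].
have hb : h != b.
  by apply: contraTneq uq => ->; rewrite /= /b /q /= mem_last.
have [pah pbq] : t E a h /\ path (t E) h q /\ t E b a.
  by move: cy; rewrite /= -/q rcons_path => /and4P[? ? ? ?]; split=> //;
    split=> //; apply/andP.
move: pbq => [pbq eba].
(* The rest of the cycle still joins [a] to [b]: its first edge ends at [h != b], and all later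
   edges avoid [a]. *)
pose E' := E :\ (a, b) :\ (b, a).
have tE' x y : t E' x y = [&& (x, y) != (b, a), (x, y) != (a, b) & t E x y].
  by rewrite /t /= !inE.
have sE' : symmetric (t E').
  move=> x y; rewrite !tE' sE !xpair_eqE.
  by case: (x == a); case: (x == b); case: (y == a); case: (y == b).
have cab : connect (t E') a b.
  apply/connectP; exists (h :: q) => //=; rewrite tE' pah !xpair_eqE eqxx.
  have ha : h != a by apply: contraNneq aq => ->; rewrite inE eqxx.
  rewrite (negPf ha) (negPf hb) andbF /=.
  apply: (sub_in_path (P := predC1 a)) pbq.
    move=> x y; rewrite !inE => xa ya; rewrite tE' !xpair_eqE.
    by rewrite (negPf xa) (negPf ya) andbF /=.
  apply/allP => x xq; rewrite inE; apply: contraNneq aq => <-.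
  by [].
have : good E'.
  apply/goodP; split=> // [x y|x y]; first by rewrite tE' => /and3P[_ _ /uE].
  apply: (connect_sub _ (cE x y)) => u v uv.
  have [[-> ->]|n1] := eqVneq (u, v) (b, a).
    by rewrite (sym_connect_sym sE').
  have [[-> ->]//|n2] := eqVneq (u, v) (a, b).
  by apply: connect1; rewrite tE' n1 n2.
move=> /minE; rewrite leqNgt => /negP; apply.
apply: proper_card; apply: sub_proper_trans (subD1set _ _) _.
by apply: properD1; rewrite sE in eba.
Qed.

(** * Trees from lists of edges, and exchange in a minimal tree *)

Section EdgeLists.
Context {R : realType} {V : normedModType R}.
Implicit Types (E : seq (V * V)) (T : ptree V) (N : {fset V}).

Definition edges_length E : R := \sum_(p <- E) `|p.1 - p.2|.

Lemma ler_sum_subseq (I : eqType) (r s : seq I) (F : I -> R) :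
  (forall i, 0 <= F i) -> uniq r -> {subset r <= s} ->
  \sum_(i <- r) F i <= \sum_(i <- s) F i.
Proof.
move=> F0; elim: r s => [|x r IH] s; first by rewrite big_nil sumr_ge0.
move=> /= /andP[xr ur] rs; have xs : x \in s by apply: rs; rewrite inE eqxx.
rewrite big_cons (perm_big _ (perm_to_rem xs)) big_cons lerD2l.
apply: IH => // y yr; have : y \in s by apply: rs; rewrite inE yr orbT.
rewrite (perm_mem (perm_to_rem xs)) inE => /predU1P[yx|//].
by rewrite -yx yr in xr.
Qed.

Lemma tree_lengthE T : tree_length T =
  (\sum_(q : vertices T * vertices T | edge q.1 q.2)
     `|fsval q.1 - fsval q.2|) / 2.
Proof. by rewrite /tree_length pair_big_dep. Qed.

(* Connectivity of E is expressed by closed sets of points: every set closed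
   under the edges that contains x0 contains all endpoints. *)
Lemma ptree_of_edges E (x0 : V) :
  {in E, forall p, (p.2, p.1) \in E} ->
  (forall P : V -> Prop, P x0 -> {in E, forall p, P p.1 -> P p.2} ->
     {in E, forall p, P p.1}) ->
  exists T, [/\ x0 \in vertices T, {in E, forall p, p.1 \in vertices T} &
    tree_length T <= edges_length E / 2].
Proof.
move=> symE conE.
pose X := (x0 |` [fset p.1 | p in E])%fset.
have x0X : x0 \in X by rewrite fset1U1.
have E1X p : p \in E -> p.1 \in X.
  by move=> pE; apply/fset1UP; right; apply/imfsetP; exists p.
have E2X p : p \in E -> p.2 \in X by move=> /symE/E1X.
(* [u != v] discards loops, since [E] may contain pairs of equal points. *)
pose e : rel X := [rel u v | (u != v) && ((val u, val v) \in E)].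
have se : symmetric e.
  by move=> u v; rewrite /e /= eq_sym; congr andb; apply/idP/idP => /symE.
have ie : irreflexive e by move=> u; rewrite /e /= eqxx.
pose r : X := [` x0X]%fset.
have re y : connect e r y.
  pose P v := exists2 u : X, val u = v & connect e r u.
  have P0 : P x0 by exists r.
  have PE p : p \in E -> P p.1 -> P p.2.
    move=> pE [u up ru]; exists [` E2X p pE]%fset => //.
    have [<-//|ne] := eqVneq u [` E2X p pE]%fset.
    by apply: connect_trans ru (connect1 _);
      rewrite /e /= ne up -surjective_pairing.
  suff [u /val_inj -> //] : P (val y).
  have /fset1UP[->//|/imfsetP[p /= pE ->]] := valP y.
  exact: conE.
have ce x y : connect e x y.
  by apply: connect_trans (re y); rewrite (sym_connect_sym se).
have X0 : (0 < #|{: X}|)%N by apply/card_gt0P; exists r.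
have [t tT te] := spanning_tree se ie X0 ce.
exists (PTree tT); split=> //.
rewrite tree_lengthE ler_pM2r ?invr_gt0//.
rewrite -big_filter -(big_map (fun q : X * X => (val q.1, val q.2)) xpredT
  (fun p => `|p.1 - p.2|)).
apply: ler_sum_subseq => //.
  rewrite map_inj_uniq; first by rewrite filter_uniq// /index_enum -enumT
    enum_uniq.
  by move=> [a b] [c d] [/val_inj-> /val_inj->].
move=> _ /mapP[q + ->]; rewrite mem_filter => /andP[/te /andP[_ //]].
Qed.

Lemma SMT_exchange N T (x : vertices T) (s : seq (vertices T)) E :
  SMT N T -> uniq s -> all (@edge _ _ T x) s ->
  (forall P : V -> Prop, P (val x) -> {in E, forall p, P p.1 <-> P p.2} ->
     {in E, forall p, P p.1} /\ {in s, forall y, P (val y)}) ->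
  \sum_(y <- s) `|val x - val y| <= edges_length E.
Proof.
move=> [NT minT] us /allP xs conE.
have [syT irT _ cT _] := edge_tree T.
have xNs : x \notin s by apply/negP => /xs; rewrite irT.
pose D (q : vertices T * vertices T) :=
  (q.1 == x) && (q.2 \in s) || (q.2 == x) && (q.1 \in s).
pose w (q : vertices T * vertices T) := (val q.1, val q.2).
pose E1 := [seq w q | q <- index_enum {: vertices T * vertices T} &
   edge q.1 q.2 && ~~ D q].
pose swap (p : V * V) := (p.2, p.1).
have w1 u v : edge u v -> ~~ D (u, v) -> (val u, val v) \in E1.
  move=> uv d; apply/mapP; exists (u, v) => //.
  by rewrite mem_filter uv d mem_index_enum.
have [|P Px clP|T' [xT' ET' lT']] := @ptree_of_edges (E1 ++ E ++ map swap E)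
  (val x).
- move=> p; rewrite !mem_cat => /or3P[].
  + move=> /mapP[q + ->] /=; rewrite mem_filter => /andP[/andP[qe qD] _].
    by rewrite w1 ?orbT// 1?syT// /D /= orbC.
  + by move=> pE; rewrite (map_f swap pE) !orbT.
  + by move=> /mapP[q qE ->]; rewrite -surjective_pairing qE orbT.
- have [p pE|PE Ps] := conE P Px.
    split; first by apply: clP; rewrite !mem_cat pE orbT.
    by apply: (clP (swap p)); rewrite !mem_cat map_f ?orbT.
  have PE' p : p \in E -> P p.2.
    by move=> pE; apply: clP (PE p pE); rewrite !mem_cat pE orbT.
  have clT (u v : vertices T) : edge u v -> P (val u) -> P (val v).
    move=> uv Pu; have [|d] := boolP (D (u, v)); last first.
      by apply: (clP (w (u, v))) Pu; rewrite mem_cat w1.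
    by move=> /orP[/andP[_ /Ps]|/andP[/eqP/=->]].
  have PT (y : vertices T) : P (val y).
    exact: (connect_ind (P := fun v => P (val v)) clT (cT x y) Px).
  move=> p; rewrite !mem_cat => /or3P[/mapP[q _ ->]|/PE//|/mapP[q qE ->]].
    exact: PT.
  exact: (PE' q qE).
(* No old vertex is lost: the points of [s] are reached by [E], and any other vertex except [x]
   keeps all its edges. *)
have VT' v : v \in vertices T -> v \in vertices T'.
  move=> vT; pose y : vertices T := [` vT]%fset.
  have [->//|vx] := eqVneq v (val x).
  have yx : y != x by apply: contraNneq vx => <-.
  have [ys|yNs] := boolP (y \in s).
    have [//|_] := conE (fun v => v \in vertices T') xT'.
      move=> p pE; split=> _.
        by apply: (ET' (swap p)); rewrite !mem_cat map_f ?orbT.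
      by apply: ET'; rewrite !mem_cat pE orbT.
    by move=> /(_ y ys).
  have /connectP[p] := cT y x.
  case: p => [|z p] /=; first by move=> _ xy; rewrite xy eqxx in yx.
  move=> /andP[yz _] _.
  have [|d] := boolP (D (y, z)); last by apply: (ET' (w (y, z)));
    rewrite mem_cat w1.
  by rewrite /D /= (negPf yNs) (negPf yx) andbF.
have NT' : steiner_tree N T'.
  by apply/fsubsetP => v /(fsubsetP NT); apply: VT'.
have := le_trans (minT _ NT') lT'.
(* [D] marks the removed edges; the kept ones occur on both sides and cancel. Both directions are
   counted, whence the factor 2. *)
rewrite tree_lengthE ler_pM2r ?invr_gt0// (bigID D) /=.
rewrite /edges_length !big_cat /= !big_map big_filter /=.
under [X in _ + (_ + X)]eq_bigr do rewrite distrC.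
rewrite addrC lerD2l -mulr2n => le1.
rewrite -(ler_pMn2r (ltn0Sn 1)); apply: le_trans le1.
pose rm := [seq (x, y) | y <- s] ++ [seq (y, x) | y <- s].
have -> : (\sum_(y <- s) `|val x - val y|) *+ 2 =
    \sum_(q <- rm) `|val q.1 - val q.2|.
  rewrite big_cat !big_map /= mulr2n; congr (_ + _).
  by apply: eq_bigr => y _; rewrite distrC.
rewrite -[leRHS]big_filter; apply: ler_sum_subseq => //.
  rewrite cat_uniq !map_inj_uniq ?us ?andbT/=;
    [|by move=> ? ? []|by move=> ? ? []].
  apply/hasPn => _ /mapP[y ys ->]; apply/negP => /mapP[z zs [yx xz]].
  by rewrite yx (negPf xNs) in ys.
move=> q; rewrite mem_filter mem_index_enum andbT mem_cat.
move=> /orP[] /mapP[y ys ->] /=; rewrite /D /= eqxx ys ?orbT ?andbT;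
  first exact: xs.
by rewrite syT; apply: xs.
Qed.

End EdgeLists.

(** * The norm in coordinates *)

Section Coordinates.
Context {R : realType} {n : nat}.
Local Notation K := (option 'I_n).
Implicit Types (x y z : MZ R n) (a b : K) (f : K -> R).

(* With the extra coordinate [None], constantly 0, the norm becomes the
   oscillation: the space is R^(n+1) modulo constants. *)
Definition zcoord z a : R := if a is Some i then (z : 'rV[R]_n) 0 i else 0.

(** Represents the class of [f] modulo constants by the function that vanishes at [None]. *)
Definition mkvec f : MZ R n := (\row_i (f (Some i) - f None) : 'rV[R]_n).

Lemma zcoord_mkvec f a : zcoord (mkvec f) a = f a - f None.
Proof. by case: a => [i|]; rewrite /= ?mxE ?subrr. Qed.

Lemma zcoord0 a : zcoord 0 a = 0.
Proof. by case: a => [i|]; rewrite /= ?mxE. Qed.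

Lemma zcoordB x y a : zcoord (x - y) a = zcoord x a - zcoord y a.
Proof. by case: a => [i|]; rewrite /= ?mxE ?subrr. Qed.

Lemma zcoordZ (l : R) x a : zcoord (l *: x) a = l * zcoord x a.
Proof. by case: a => [i|]; rewrite /= ?mxE ?mulr0. Qed.

Lemma zcoord_inj x y : zcoord x =1 zcoord y -> x = y.
Proof. by move=> xy; apply/rowP => i; apply: (xy (Some i)). Qed.

(** The half-space [H] is convex and contains both cubes, hence the unit ball; the general case
    follows by scaling. *)
Lemma zcoordB_le_norm z a b : zcoord z a - zcoord z b <= `|z|.
Proof.
pose H : set 'rV[R]_n := [set y : 'rV[R]_n | zcoord y a - zcoord y b <=
  1]%classic.
have zcoordD (u v : 'rV[R]_n) (s t : R) c :
    zcoord (s *: u + t *: v : 'rV[R]_n) c = s * zcoord u c + t * zcoord v c.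
  by case: c => [i|]; rewrite /= ?mxE ?mulr0 ?addr0.
have cH : convex_set H.
  apply/convex_setW => u v; rewrite !classical_sets.in_setE /H /= => hu hv l l0
    l1.
  have -> : (conv l (u : convex_lmodType _) v : 'rV[R]_n) =
    l%:num *: u + (1 - l%:num) *: v by [].
  move: (l%:num) l0 l1 => t t0 t1; rewrite classical_sets.in_setE /= !zcoordD;
    nra.
have ZH : (@Zball R n `<=` H)%classic.
  apply: smallest_sub => // u [] /= u01; rewrite /H /=.
    move: (a) (b) => [i|] [j|] /=; rewrite ?subrr//.
    - by have /andP[? ?] := u01 i; have /andP[? ?] := u01 j; lra.
    - by have /andP[? ?] := u01 i; lra.
    - by have /andP[? ?] := u01 j; lra.
  move: (a) (b) => [i|] [j|] /=; rewrite ?subrr//.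
  - by have /andP[? ?] := u01 i; have /andP[? ?] := u01 j; lra.
  - by have /andP[? ?] := u01 i; lra.
  - by have /andP[? ?] := u01 j; lra.
have [->|z0] := eqVneq z 0.
  by rewrite normr0 !zcoord0 subrr.
have nz : 0 < `|z| by rewrite normr_gt0.
have : H (`|z|^-1 *: z).
  apply: ZH; rewrite -MZ_unit_ball /= normrZ normfV normr_id mulVf//.
  by rewrite gt_eqF.
by rewrite /H /= !zcoordZ -mulrBr mulrC ler_pdivrMr// mul1r.
Qed.

(** With [M] the largest coordinate, the positive part of [z] lies in [M] times the cube [0,1]^n and
    the rest in [r - M] times [-1,0]^n. *)
Lemma norm_le_osc z (r : R) :
  (forall a b, zcoord z a - zcoord z b <= r) -> `|z| <= r.
Proof.
move=> zr.
have cube (l : R) (s : R) y : (s = 1 \/ s = -1) -> 0 <= l ->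
    (forall i, 0 <= s * zcoord y (Some i) <= l) -> `|y| <= l.
  move=> s1; rewrite le_eqVlt => /predU1P[<- y0|l0 yl].
    suff -> : y = 0 by rewrite normr0.
    apply: zcoord_inj => -[i|//]; rewrite [RHS]/= mxE.
    by have := y0 i; rewrite -eq_le => /eqP; case: s1 => ->; lra.
  have : Zball (l^-1 *: y : 'rV[R]_n).
    move=> B [_]; apply; case: s1 => s1; [left|right] => i /=; rewrite mxE;
      have := yl i; rewrite s1 /= => /andP[h1 h2];
      rewrite mulrC ?ler_pdivlMr ?ler_pdivrMr ?mulN1r ?mul0r ?mul1r//;
      apply/andP; split; lra.
  rewrite -MZ_unit_ball /= normrZ normfV gtr0_norm// mulrC.
  by rewrite ler_pdivrMr// mul1r.
have [/= c _ cmax] := @Order.TotalTheory.arg_maxP _ _ _ None xpredT (zcoord z)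
  isT.
set M := zcoord z c in cmax *.
have M0 : 0 <= M by have := cmax None isT.
have Mr : M <= r by have := zr c None; rewrite subr0.
pose u := mkvec (fun a => Num.max (zcoord z a) 0).
have uE a : zcoord u a = Num.max (zcoord z a) 0.
  by rewrite zcoord_mkvec /= maxxx subr0.
rewrite -[z](subrK u) -[leRHS](subrK M); apply: le_trans (ler_normD _ _) _.
apply: lerD.
  apply: (cube _ (-1)); rewrite ?subr_ge0//; first by right.
  move=> i; rewrite zcoordB uE; have := zr c (Some i); rewrite -/M.
  have := cmax (Some i) isT; case: (leP (zcoord z (Some i)) 0) => ? ? ?;
    apply/andP; split; lra.
apply: (cube _ 1) => //; first by left.
move=> i; rewrite uE; have := cmax (Some i) isT.
by case: (leP (zcoord z (Some i)) 0) => ? ?; apply/andP; split; lra.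
Qed.

Definition argmax z : {set K} := [set a | [forall b, zcoord z b <= zcoord z a]].

Lemma argmaxP z a : reflect (forall b, zcoord z b <= zcoord z a) (a \in argmax
  z).
Proof. by rewrite inE; apply: forallP. Qed.

Lemma argmax_neq0 z : argmax z != set0.
Proof.
have [c _ cmax] := @Order.TotalTheory.arg_maxP _ _ _ None xpredT (zcoord z) isT.
by apply/set0Pn; exists c; apply/argmaxP => b; apply: cmax.
Qed.

Lemma argmax_gap z : exists2 d : R, 0 < d &
  forall a b, a \in argmax z -> b \notin argmax z -> zcoord z b + d <= zcoord z
    a.
Proof.
have [/set0Pn[c cz]] := argmax_neq0 z.
have cP a : zcoord z a <= zcoord z c by apply/argmaxP.
have lt b : b \notin argmax z -> 0 < zcoord z c - zcoord z b.
  move=> bz; rewrite subr_gt0 lt_neqAle cP andbT; apply: contraNneq bz => e.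
  by apply/argmaxP => a; rewrite e.
(* The default 1 keeps the minimum positive when all coordinates are maximal. *)
exists (\big[Num.min/1]_(b | b \notin argmax z) (zcoord z c - zcoord z b)).
  by elim/big_ind: _ => // x y x0 y0; rewrite lt_min x0.
move=> a b /argmaxP az bz; rewrite addrC -lerBrDr.
apply: le_trans (bigmin_le_cond _ (P := [pred b | b \notin argmax z]) _ bz) _.
by rewrite lerB.
Qed.

(* Moving from 0 in a direction in which all maximal coordinates of z gain
   relative to the others shortens the distance to z at unit rate. *)
Lemma norm_shift z : z != 0 -> exists2 d : R, 0 < d &
  forall (e : R) f, 0 < e <= d -> (forall a, 0 <= f a <= 2) ->
  (forall a b, a \in argmax z -> b \notin argmax z -> f b + 1 <= f a) ->
  `|z - e *: mkvec f| <= `|z| - e.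
Proof.
move=> z0; have [d d0 gap] := argmax_gap z.
have nz : 0 < `|z| by rewrite normr_gt0.
(* As [f] varies by at most 2, [3 e <= d] handles pairs with [a] not maximal, and 3 e at most the
   norm of [z] those with both maximal; the other pairs use the gap of [f]. *)
exists (Num.min d `|z| / 3) => [|e f].
  by rewrite divr_gt0// lt_min d0.
rewrite ler_pdivlMr// le_min => /and3P[e0 ed ez] f2 fgap.
apply: norm_le_osc => a b; rewrite !zcoordB !zcoordZ !zcoord_mkvec.
have /andP[fa0 fa2] := f2 a; have /andP[fb0 fb2] := f2 b.
have [/set0Pn[c cz]] := argmax_neq0 z.
have [az|az] := boolP (a \in argmax z); last first.
  have := gap _ _ cz az; have := zcoordB_le_norm z c b; nra.
have [bz|bz] := boolP (b \in argmax z); last first.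
  have := zcoordB_le_norm z a b; have := fgap _ _ az bz; nra.
have /argmaxP/(_ a) := bz; nra.
Qed.

End Coordinates.

(** * Upper bound *)

Section UpperBound.
Context {R : realType} {n : nat}.
Local Notation K := (option 'I_n).
Local Notation V := (MZ R n : normedModType R).

Definition ind (S : {set K}) (a : K) : R := (a \in S)%:R.

Lemma mkvecB (f g : K -> R) : mkvec f - mkvec g = mkvec (fun a => f a - g a).
Proof. by apply: zcoord_inj => a; rewrite zcoordB !zcoord_mkvec; lra. Qed.

Lemma ind_itv S a : 0 <= ind S a <= 1.
Proof. by rewrite /ind; case: (a \in S); rewrite ?lexx ler01. Qed.

Lemma indD_itv S S' a : 0 <= ind S a + ind S' a <= 2.
Proof. by have /andP[? ?] := ind_itv S a; have /andP[? ?] := ind_itv S' a;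
  lra. Qed.

Lemma indB_le1 S a b : ind S a - ind S b <= 1.
Proof. by have := ind_itv S a; have := ind_itv S b; lra. Qed.

Lemma ind_itv2 S a : 0 <= ind S a <= 2.
Proof. by have := ind_itv S a; lra. Qed.

Lemma norm_mkvec_le (f : K -> R) (r : R) :
  (forall a b, f a - f b <= r) -> `|mkvec f| <= r.
Proof.
move=> fr; apply: norm_le_osc => a b; rewrite !zcoord_mkvec.
by rewrite opprB addrA subrK.
Qed.

Variables (N : {fset V}) (T : ptree V) (x : vertices T).
Hypothesis minT : SMT N T.

Let nbr := [set y | edge x y].
Let dir (y : vertices T) : MZ R n := val y - val x.
Let top (y : vertices T) := argmax (dir y).

Let dir_neq0 y : y \in nbr -> dir y != 0.
Proof.
rewrite inE subr_eq0 => xy; apply: contraTneq xy => /val_inj->.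
by have [_ ->] := edge_tree T.
Qed.

(* The tree in which y1 and y2 are joined to x through x + e chi_S, for small
   e, would be shorter. *)
Let top_inj : {in nbr &, injective top}.
Proof.
move=> y1 y2 y1x y2x top12; apply/eqP; apply: contraT => ne12.
have arith (c A B1 B2 D1 D2 : R) : 0 < c -> A <= c -> B1 <= D1 - c ->
    B2 <= D2 - c -> D1 + (D2 + 0) <= A + (B1 + (B2 + 0)) -> false by lra.
have [d1 d10 sh1] := norm_shift (dir_neq0 y1x).
have [d2 d20 sh2] := norm_shift (dir_neq0 y2x).
pose e := Num.min d1 d2; have e0 : 0 < e by rewrite lt_min d10.
pose f := ind (top y1).
have ftop a b : a \in top y1 -> b \notin top y1 -> f b + 1 <= f a.
  by rewrite /f /ind => -> /negPf->; rewrite add0r.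
have s1 : `|dir y1 - e *: mkvec f| <= `|dir y1| - e.
  by apply: sh1 => //; [by rewrite e0 ge_min lexx|exact: ind_itv2].
have s2 : `|dir y2 - e *: mkvec f| <= `|dir y2| - e.
  apply: sh2; [by rewrite e0 ge_min lexx orbT|exact: ind_itv2|].
  by rewrite -/(top y2) -top12.
have f1 : `|e *: mkvec f| <= e.
  rewrite normrZ gtr0_norm// -[leRHS]mulr1 ler_pM2l//;
    apply: norm_mkvec_le => a b.
  exact: indB_le1.
pose s : V := val x + e *: mkvec f.
have := @SMT_exchange _ _ N T x [:: y1; y2]
  [:: (val x, s); (s, val y1); (s, val y2)] minT.
rewrite /= !inE ne12 andbT => /(_ isT).
move: (y1x) (y2x); rewrite ![_ \in nbr]inE => -> -> => /(_ isT).
rewrite /edges_length !big_cons !big_nil /= => exch.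
have : `|val x - val y1| + (`|val x - val y2| + 0) <=
    `|val x - s| + (`|s - val y1| + (`|s - val y2| + 0)).
  apply: exch => P Px cl.
  have Ps : P s by apply/(cl (val x, s)); rewrite ?inE ?eqxx.
  have P1 : P (val y1) by apply/(cl (s, val y1)); rewrite ?inE ?eqxx ?orbT.
  have P2 : P (val y2) by apply/(cl (s, val y2)); rewrite ?inE ?eqxx ?orbT.
  split=> [p|y]; rewrite !inE; first by case/or3P => /eqP->.
  by case/orP => /eqP->.
have -> : val x - s = - (e *: mkvec f) by rewrite /s opprD addrA subrr add0r.
have sy y : `|s - val y| = `|dir y - e *: mkvec f|.
  by rewrite distrC /s /dir opprD addrA.
rewrite !sy normrN ![ `|val x - _|]distrC -/(dir y1) -/(dir y2).
exact: arith e0 f1 s1 s2.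
Qed.

(* For a chain S1 < S2 < S3, the tree with x joined to s, s to t and y2, and t
   to y1 and y3, where s = x + e chi_S2 and t = x + e (chi_S1 + chi_S3) for
   small e, would be shorter. *)
Let top_no_chain y1 y2 y3 : y1 \in nbr -> y2 \in nbr -> y3 \in nbr ->
  top y1 \proper top y2 -> ~~ (top y2 \proper top y3).
Proof.
move=> y1x y2x y3x p12; apply/negP => p23.
have arith (c A1 A2 B1 B2 B3 D1 D2 D3 : R) : 0 < c -> A1 <= c -> A2 <= c ->
    B1 <= D1 - c -> B2 <= D2 - c -> B3 <= D3 - c ->
    D1 + (D2 + (D3 + 0)) <= A1 + (B2 + (A2 + (B1 + (B3 + 0)))) -> False by lra.
have [d1 d10 sh1] := norm_shift (dir_neq0 y1x).
have [d2 d20 sh2] := norm_shift (dir_neq0 y2x).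
have [d3 d30 sh3] := norm_shift (dir_neq0 y3x).
pose e := Num.min d1 (Num.min d2 d3).
have e0 : 0 < e by rewrite !lt_min d10 d20.
pose f := ind (top y2); pose g a := ind (top y1) a + ind (top y3) a.
have /subsetP sub12 := proper_sub p12; have /subsetP sub23 := proper_sub p23.
(* [g] is 2 on the smallest set, 1 on the rest of the largest and 0 outside, so it has the required
   gap for both [y1] and [y3]. *)
have s1 : `|dir y1 - e *: mkvec g| <= `|dir y1| - e.
  apply: sh1; [by rewrite e0 ge_min lexx|exact: indD_itv|].
  move=> a b a1 b1; rewrite /g /ind a1 (negPf b1) (sub23 _ (sub12 _ a1)) add0r.
  by rewrite lerD2r; case: (b \in _).
have s2 : `|dir y2 - e *: mkvec f| <= `|dir y2| - e.
  apply: sh2; [by rewrite e0 !ge_min lexx orbT|exact: ind_itv2|].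
  by move=> a b; rewrite /f /ind => -> /negPf->; rewrite add0r.
have s3 : `|dir y3 - e *: mkvec g| <= `|dir y3| - e.
  apply: sh3; [by rewrite e0 !ge_min lexx !orbT|exact: indD_itv|].
  move=> a b a3 b3; have b1 : b \notin top y1.
    by apply: contraNN b3 => /sub12/sub23.
  by rewrite /g /ind a3 (negPf b3) (negPf b1) !add0r lerDr; case: (a \in _).
have f1 : `|e *: mkvec f| <= e.
  rewrite normrZ gtr0_norm// -[leRHS]mulr1 ler_pM2l//;
    apply: norm_mkvec_le => a b.
  exact: indB_le1.
have fg1 : `|e *: mkvec (fun a => f a - g a)| <= e.
  rewrite normrZ gtr0_norm// -[leRHS]mulr1 ler_pM2l//;
    apply: norm_mkvec_le => a b.
  (* For the chain S1 < S2 < S3, [f - g] is -1 on S1 and on S3 minus S2, and 0 elsewhere. *)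
  have fgE c : f c - g c = - ind (top y1 :|: (top y3 :\: top y2)) c.
    rewrite /f /g /ind in_setU in_setD; case: (boolP (c \in top y1)) => c1.
      by rewrite (sub12 _ c1) (sub23 _ (sub12 _ c1)) /= opprD addrCA subrr
        addr0.
    rewrite add0r; case: (boolP (c \in top y2)) => c2 /=.
      by rewrite (sub23 _ c2) subrr oppr0.
    by rewrite sub0r.
  by rewrite !fgE opprK addrC indB_le1.
pose s : V := val x + e *: mkvec f.
pose t : V := val x + e *: mkvec g.
have ne y y' : top y \proper top y' -> y != y'.
  by apply: contraTneq => ->; rewrite properxx.
have := @SMT_exchange _ _ N T x [:: y1; y2; y3]
  [:: (val x, s); (s, val y2); (s, t); (t, val y1); (t, val y3)] minT.
rewrite /= !inE (negPf (ne _ _ p12)) (negPf (ne _ _ p23)).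
rewrite (negPf (ne _ _ (proper_trans p12 p23))) => /(_ isT).
move: (y1x) (y2x) (y3x); rewrite ![_ \in nbr]inE => -> -> -> => /(_ isT).
rewrite /edges_length !big_cons !big_nil /= => exch.
have : `|val x - val y1| + (`|val x - val y2| + (`|val x - val y3| + 0)) <=
    `|val x - s| + (`|s - val y2| + (`|s - t| + (`|t - val y1| + (`|t - val y3|
      + 0)))).
  apply: exch => P Px cl.
  have Ps : P s by apply/(cl (val x, s)); rewrite ?inE ?eqxx.
  have Pt : P t by apply/(cl (s, t)); rewrite ?inE ?eqxx ?orbT.
  have P1 : P (val y1) by apply/(cl (t, val y1)); rewrite ?inE ?eqxx ?orbT.
  have P2 : P (val y2) by apply/(cl (s, val y2)); rewrite ?inE ?eqxx ?orbT.
  have P3 : P (val y3) by apply/(cl (t, val y3)); rewrite ?inE ?eqxx ?orbT.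
  split=> [p|y]; rewrite !inE; last by case/or3P => /eqP->.
  by move=> /orP[|/orP[|/or3P[]]] /eqP->.
have -> : val x - s = - (e *: mkvec f) by rewrite /s opprD addrA subrr add0r.
have -> : s - t = e *: mkvec (fun a => f a - g a).
  by rewrite /s /t opprD addrACA subrr add0r -scalerBr mkvecB.
have sy h y : `|val x + e *: mkvec h - val y| = `|dir y - e *: mkvec h|.
  by rewrite distrC /dir opprD addrA.
rewrite !sy normrN ![ `|val x - _|]distrC -/(dir y1) -/(dir y2) -/(dir y3).
exact: arith e0 f1 fg1 s1 s2 s3.
Qed.

Lemma SMT_degree_le : (degree (@edge _ _ T) x <= 'C(n + 2, (n + 2)./2))%N.
Proof.
rewrite /degree -(card_in_imset top_inj).
have := @no_3chain_card _ (top @: nbr); rewrite card_option card_ord addn2.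
apply=> _ _ _ /imsetP[y1 y1x ->] /imsetP[y2 y2x ->] /imsetP[y3 y3x ->].
exact: top_no_chain.
Qed.

End UpperBound.

(** * Lower bound *)

Section LowerBound.
Context {R : realType} {n : nat}.
Local Notation K := (option 'I_n).
Local Notation V := (MZ R n : normedModType R).
Implicit Types (I : {set {set K}}) (S L U : {set K}) (l : R).

Variable k : nat.
Hypotheses (k0 : (0 < k)%N) (kn : (k < n)%N).

Definition levels : {set {set K}} := [set S : {set K} | (#|S| == k) || (#|S| ==
  k.+1)].

(** Pascal's rule, for subsets of the [n + 1] elements of [K]. *)
Lemma card_levels : #|levels| = 'C(n.+2, k.+1).
Proof.
have -> : levels = [set S : {set K} | #|S| == k] :|: [set S : {set K} | #|S| ==
  k.+1].
  by apply/setP => S; rewrite !inE.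
rewrite cardsU !card_draws card_option card_ord.
rewrite (_ : _ :&: _ = set0) ?cards0 ?subn0 1?addnC//.
by apply/setP => S; rewrite !inE; apply/negP => /andP[/eqP->]; rewrite ltn_eqF.
Qed.

Lemma levels_card S : S \in levels -> (k <= #|S| <= k.+1)%N.
Proof. by rewrite inE => /orP[]/eqP->; rewrite !leqnn ?leqnSn. Qed.

Lemma levels_neq0 S : S \in levels -> exists a, a \in S.
Proof.
move=> /levels_card/andP[Sk _]; apply/set0Pn; rewrite -card_gt0.
exact: leq_trans Sk.
Qed.

Lemma levels_proper S : S \in levels -> exists b, b \notin S.
Proof.
move=> /levels_card/andP[_ Sk]; apply/existsP.
have /set0Pn[b] : ~: S != set0.
  by rewrite -card_gt0 -subn_gt0 in Sk *; rewrite cardsCs setCK card_option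
    card_ord; lia.
by rewrite inE => bS; apply/existsP; exists b.
Qed.

(** Two different members have a union of at least [k + 1] elements, so a member containing both
    equals the union. *)
Lemma levels_C4_free L1 L2 U1 U2 :
  {subset [:: L1; L2; U1; U2] <= levels} -> L1 != L2 ->
  L1 :|: L2 \subset U1 -> L1 :|: L2 \subset U2 -> U1 = U2.
Proof.
move=> lev ne12.
have lt : (k < #|L1 :|: L2|)%N.
  have [L1L levL2] : L1 \in levels /\ L2 \in levels.
    by split; apply: lev; rewrite !inE eqxx ?orbT.
  have /andP[c1 _] := levels_card L1L; have /andP[c2 _] := levels_card levL2.
  have [s12|] := boolP (L1 \subset L2).
    apply: leq_ltn_trans c1 _; apply: proper_card.
    rewrite (setUidPr s12) properEneq ne12; exact: s12.
  move=> ns; apply: leq_ltn_trans c2 _; apply: proper_card.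
  rewrite properEneq subsetUr andbT; apply: contraNneq ns => ->.
  exact: subsetUl.
have eqU U : U \in levels -> L1 :|: L2 \subset U -> L1 :|: L2 = U.
  move=> /levels_card/andP[_ cU] sU; apply/eqP; rewrite eqEcard sU.
  exact: leq_trans lt.
move=> /eqU<-; last by apply: lev; rewrite !inE eqxx ?orbT.
by move=> /eqU<- //; apply: lev; rewrite !inE eqxx ?orbT.
Qed.

Definition chi S : V := mkvec (ind S).

Lemma zcoord_chiB S a b : zcoord (chi S) a - zcoord (chi S) b = ind S a - ind S
  b :> R.
Proof. by rewrite !zcoord_mkvec opprB addrA subrK. Qed.

Lemma chi_neq0 S : S \in levels -> chi S != 0.
Proof.
move=> SF; have [a aS] := levels_neq0 SF; have [b bS] := levels_proper SF.
apply/eqP => S0; have := zcoord_chiB S a b.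
by rewrite S0 !zcoord0 /ind aS (negPf bS) /=; lra.
Qed.

(** Only the indicator modulo constants is known, but an element inside [S] and one outside fix the
    constant. *)
Lemma chi_inj : {in levels &, injective chi}.
Proof.
move=> S S' SF S'F E; apply/setP => c.
have d a b : ind S a - ind S b = ind S' a - ind S' b :> R.
  by rewrite -!zcoord_chiB E.
have [a aS] := levels_neq0 SF; have [b bS] := levels_proper SF.
have := ind_itv (R := R) S' a; have := ind_itv (R := R) S' b.
move: (d a c) (d b c); rewrite /ind aS (negPf bS).
by case: (c \in S); case: (c \in S') => //=; lra.
Qed.

(* A lower bound for the length l of a tree connecting v to the points chi S,
   S in I: writing l >= |I| - phi(v), the functional phi is 0 in the first
   case, and any e_a - e_b with a in L and b outside U in the second one. *)
Definition tree_bound (v : V) I l :=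
  #|I|%:R <= l \/
  exists L U, [/\ L \in I, U \in I, L \subset U &
    forall a b, a \in L -> b \notin U -> #|I|%:R - (zcoord v a - zcoord v b) <=
      l].

Lemma tree_bound_le (v : V) I l l' : l <= l' -> tree_bound v I l -> tree_bound
  v I l'.
Proof.
move=> ll' [Il|[L [U [LI UI LU H]]]]; first by left; apply: le_trans ll'.
right; exists L, U; split=> // a b aL bU; exact: le_trans (H a b aL bU) ll'.
Qed.

Lemma tree_bound_move (u v : V) I l :
  tree_bound v I l -> tree_bound u I (l + `|u - v|).
Proof.
move=> [Il|[L [U [LI UI LU H]]]]; first by left; rewrite ler_wpDr.
right; exists L, U; split=> // a b aL bU.
have := H a b aL bU; have := zcoordB_le_norm (v - u) a b.
by rewrite !zcoordB distrC; lra.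
Qed.

(* If both L2 <= U1 and L1 <= U2 then L1, L2, U1, U2 form a 4-cycle, which two
   adjacent levels do not contain. Otherwise the two functionals can be chosen
   such that an e_c cancels. *)
Lemma tree_bound_merge (v : V) I1 I2 l1 l2 :
  I1 \subset levels -> I2 \subset levels -> [disjoint I1 & I2] ->
  tree_bound v I1 l1 -> tree_bound v I2 l2 -> tree_bound v (I1 :|: I2) (l1 +
    l2).
Proof.
move=> /subsetP s1 /subsetP s2 dis.
have card12 : #|I1 :|: I2|%:R = #|I1|%:R + #|I2|%:R :> R.
  by rewrite cardsU disjoint_setI0// cards0 subn0 natrD.
rewrite /tree_bound card12.
move=> [h1|[L1 [U1 [LI1 UI1 LU1 h1]]]] [h2|[L2 [U2 [LI2 UI2 LU2 h2]]]].
- by left; rewrite lerD.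
- right; exists L2, U2; rewrite !inE LI2 UI2 !orbT; split=> // a b aL bU.
  by have := h2 a b aL bU; lra.
- right; exists L1, U1; rewrite !inE LI1 UI1; split=> // a b aL bU.
  by have := h1 a b aL bU; lra.
have [L2U1|/subsetPn[c cL2 cU1]] := boolP (L2 \subset U1);
  have [L1U2|/subsetPn[d dL1 dU2]] := boolP (L1 \subset U2).
- have neq (A B : {set K}) : A \in I1 -> B \in I2 -> A != B.
    by move=> AI BI; apply: contraTneq AI => ->; rewrite (disjointFl dis).
  case/eqP: (neq _ _ UI1 UI2).
  apply: (@levels_C4_free L1 L2) (neq _ _ LI1 LI2) _ _;
    rewrite ?subUset ?LU1 ?LU2 ?L2U1 ?L1U2//.
  by move=> S; rewrite !in_cons orbF => /or4P[]/eqP->;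
    [exact: s1|exact: s2|exact: s1|exact: s2].
- right; exists L2, U1; rewrite !inE LI2 UI1 orbT; split=> // a b aL bU.
  by have := h1 d b dL1 bU; have := h2 a d aL dU2; lra.
- right; exists L1, U2; rewrite !inE LI1 UI2 orbT; split=> // a b aL bU.
  by have := h1 a c aL cU1; have := h2 c b cL2 bU; lra.
(* Here e_d - e_c and e_c - e_d cancel completely. *)
- by left; have := h1 d c dL1 cU1; have := h2 c d cL2 dU2; lra.
Qed.

(** Over ordered pairs: twice the length of the subgraph induced by [W]. *)
Definition pairs_length (T : ptree V) (W : {set vertices T}) : R :=
  \sum_(q : vertices T * vertices T | [&& q.1 \in W, q.2 \in W & edge q.1 q.2])
    `|val q.1 - val q.2|.

Lemma pairs_length_setU1 (T : ptree V) (W : {set vertices T}) (u v : vertices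
  T) :
  u \in W -> v \notin W -> edge u v ->
  pairs_length W + `|val u - val v| *+ 2 <= pairs_length (v |: W).
Proof.
move=> uW vW uv; rewrite [leRHS](bigID (fun q => (q.1 \in W) && (q.2 \in W)))
  /=.
have [syT _ _ _ _] := edge_tree T.
apply: lerD.
  rewrite le_eqVlt; apply/orP; left; apply/eqP; apply: eq_bigl => q.
  by rewrite !in_setU; case: (q.1 \in W); case: (q.2 \in W);
    rewrite /= ?orbT ?andbT ?andbF.
rewrite -[leRHS]big_filter.
have -> : `|val u - val v| *+ 2 =
    \sum_(q <- [:: (u, v); (v, u)]) `|val q.1 - val q.2|.
  by rewrite !big_cons big_nil addr0 /= mulr2n [X in _ + X]distrC.
apply: ler_sum_subseq => //.
  by rewrite /= andbT inE xpair_eqE; apply: contraNN vW => /andP[/eqP<-].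
move=> q; rewrite mem_filter mem_index_enum andbT !inE.
by case/orP => /eqP-> /=; rewrite (negPf vW) uW eqxx ?orbT ?andbF /= ?[edge v
  u]syT uv.
Qed.

Lemma levels_tree_length (T : ptree V) :
  0 \in vertices T -> {in levels, forall S, chi S \in vertices T} ->
  #|levels|%:R <= tree_length T.
Proof.
move=> oT FT; have [syT irT _ cT _] := edge_tree T.
pose X : finType := vertices T; pose r : X := [` oT]%fset.
(* At each vertex [v] of [W] hangs a branch of length [l v] reaching the points of [I v]. These
   bounds combine with the edges inside [W] into one at the root. *)
pose P (W : {set X}) := forall (l : X -> R) (I : X -> {set {set K}}),
  {in W, forall v : X, tree_bound (fsval v) (I v) (l v)} ->
  {in W, forall v, I v \subset levels} ->
  {in W &, forall v w, v != w -> [disjoint I v & I w]} ->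
  tree_bound (fsval r) (\bigcup_(v in W) I v)
    (\sum_(v in W) l v + pairs_length W / 2).
have PT : P [set: X].
  apply: (connected_grow (cT r)) => [l I bnd _ _|W u v PW rW uW vW uv l I bnd
    lev dis].
    rewrite !big_set1; apply: tree_bound_le (bnd r _); last by rewrite inE.
    by rewrite lerDl divr_ge0// sumr_ge0.
  have ne w : w \in W -> v != w by apply: contraTneq => <-.
  have inU w : w \in W -> w \in v |: W by rewrite in_setU => ->; rewrite orbT.
  have vU : v \in v |: W by rewrite setU11.
  (* The branch at the newest vertex [v] is moved along the edge to [u] and merged with the branch
     there, which leaves data on [W]. *)
  pose l' w := if w == u then l u + (l v + `|fsval u - fsval v|) else l w.
  pose I' w := if w == u then I u :|: I v else I w.
  have H : tree_bound (fsval r) (\bigcup_(w in W) I' w)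
      (\sum_(w in W) l' w + pairs_length W / 2).
    apply: PW => [w wW|w wW|w1 w2 w1W w2W w12]; rewrite /l' /I'.
    - have [->|_] := eqVneq w u; last exact/bnd/inU.
      apply: tree_bound_merge.
      + exact/lev/inU.
      + exact: lev.
      + by rewrite disjoint_sym dis// ?inU// ne.
      + exact/bnd/inU.
      + by apply: tree_bound_move; apply: bnd.
    - have [_|_] := eqVneq w u; last exact/lev/inU.
      by rewrite subUset !lev// inU.
    - have [w1u|w1u] := eqVneq w1 u; have [w2u|w2u] := eqVneq w2 u.
      + by rewrite w1u w2u eqxx in w12.
      + rewrite -setI_eq0 setIUl setU_eq0 !setI_eq0.
        apply/andP; split; apply: dis.
        * exact: inU.
        * exact: inU.
        * by rewrite eq_sym.
        * exact: vU.
        * exact: inU.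
        * exact: ne.
      + rewrite -setI_eq0 setIUr setU_eq0 !setI_eq0.
        apply/andP; split; apply: dis.
        * exact: inU.
        * exact: inU.
        * by [].
        * exact: inU.
        * exact: vU.
        * by rewrite eq_sym ne.
      + by apply: dis => //; apply: inU.
  have <- : \bigcup_(w in W) I' w = \bigcup_(w in v |: W) I w.
    rewrite big_setU1//= [RHS]setUC !(bigD1 (P := mem W) u uW) /= /I' eqxx.
    rewrite -setUA [I v :|: _]setUC setUA; congr (_ :|: _ :|: _).
    by apply: eq_bigr => w /andP[_ /negPf->].
  apply: tree_bound_le H; rewrite big_setU1//= /l' !(bigD1 (P := mem W) u uW)
    /= eqxx.
  rewrite (eq_bigr l) => [|w /andP[_ /negPf->]//].
  by have := pairs_length_setU1 uW vW uv; rewrite mulr2n; lra.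
(* Initially all branches have length 0 and [I v] holds at most one [S], by [chi_inj]; its
   functionals take the value 1 at [chi S]. *)
have := PT (fun=> 0) (fun v : X => [set S in levels | chi S == fsval v]).
have -> : \bigcup_(v in [set: X]) [set S in levels | chi S == fsval v] = levels.
  apply/setP => S; apply/bigcupP/idP => [[v _]|SF];
    first by rewrite inE => /andP[].
  by exists [` FT S SF]%fset; rewrite ?in_setT // inE SF /=.
have -> : \sum_(v in [set: X]) 0 + pairs_length [set: X] / 2 = tree_length T.
  rewrite big1// add0r tree_lengthE; congr (_ / 2); apply: eq_bigl => q.
  by rewrite !inE.
case=> [v _|v _|v w _ _ vw||[L [U [LF UF _ H]]]] //.
- have [->|/set0Pn[S]] := eqVneq [set S in levels | chi S == fsval v] set0.
    by left; rewrite cards0.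
  rewrite inE => /andP[SF /eqP Sv]; right; exists S, S.
  rewrite inE SF Sv eqxx subxx; split=> // a b aS bS.
  rewrite -Sv zcoord_chiB /ind aS (negPf bS).
  have -> : [set S0 in levels | chi S0 == chi S] = [set S].
    apply/setP => S'; rewrite inE in_set1; apply/andP/eqP => [[S'F /eqP]|->//].
    exact: chi_inj.
  by rewrite cards1 subr0 subrr.
- by apply/subsetP => S; rewrite inE => /andP[].
- rewrite -setI_eq0; apply/eqP/setP => S; rewrite in_setI inE [in X in _ &&
  X]inE in_set0.
  apply/negP => /andP[/andP[_ /eqP Sv] /andP[_ /eqP Sw]].
  by case/eqP: vw; apply: val_inj; apply: etrans (esym Sv) Sw.
(* The root is 0, where every functional vanishes. *)
have [a aL] := levels_neq0 LF; have [b bU] := levels_proper UF.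
apply: le_trans (H a b aL bU); rewrite lerBrDr gerDl /=.
by rewrite !zcoord0 subrr.
Qed.

Lemma levels_star : given_degrees V #|levels|.
Proof.
pose N : {fset V} := (0 |` [fset chi S | S in levels])%fset.
have oN : 0 \in N by rewrite fset1U1.
have chiN S : S \in levels -> chi S \in N.
  by move=> SF; apply/fset1UP; right; apply/imfsetP; exists S.
pose r : N := [` oN]%fset.
(* The full star at [r]. [spanning_tree] supplies acyclicity, and [tr] shows that no edge of the
   star is lost. *)
pose e : rel N := [rel x y | (x == r) (+) (y == r)].
have se : symmetric e by move=> x y; rewrite /e /= addbC.
have ie : irreflexive e by move=> x; rewrite /e /= addbb.
have re x : connect e r x.
  have [->//|xr] := eqVneq x r.
  by apply: connect1; rewrite /e /= eqxx (negPf xr).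
have ce x y : connect e x y.
  by apply: connect_trans (re y); rewrite (sym_connect_sym se).
have N0 : (0 < #|{: N}|)%N by apply/card_gt0P; exists r.
have [t tT te] := spanning_tree se ie N0 ce.
have [st _ _ ct _] := tT.
have tr x : x != r -> t r x.
  move=> xr; have /connectP[[|y p] /=] := ct x r.
    by move=> _ rx; rewrite rx eqxx in xr.
  move=> /andP[xy _] _; have := te _ _ xy.
  by rewrite /e /= (negPf xr) => /eqP yr; rewrite st -yr.
pose g S : N := insubd r (chi S).
have valg S : S \in levels -> val (g S) = chi S.
  by move=> SF; rewrite val_insubd chiN.
have nbrE : [set y | t r y] = [set g S | S in levels].
  apply/setP => y; rewrite inE; apply/idP/imsetP => [ry|[S SF ->]].
    have yr : y != r by have := te _ _ ry; rewrite /e /= eqxx.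
    have /fset1UP[y0|/imfsetP[S /= SF yS]] := valP y.
      by case/eqP: yr; apply: val_inj.
    by exists S => //; apply: val_inj; rewrite valg.
  apply: tr; apply: contraTneq (chi_neq0 SF) => gr.
  by rewrite -valg// gr eqxx.
have card_nbr : #|[set y | t r y]| = #|levels|.
  rewrite nbrE card_in_imset// => S S' SF S'F gg.
  by apply: chi_inj => //; rewrite -!valg// gg.
have norm_nbr y : t r y -> `|val y| <= 1.
  have : y \in [set y | t r y] -> `|val y| <= 1.
    rewrite nbrE => /imsetP[S SF ->]; rewrite valg//;
      apply: norm_mkvec_le => a b.
    by rewrite /ind; case: (a \in S); case: (b \in S); rewrite /=; lra.
  by rewrite inE.
exists N, (PTree tT), r; split=> //; split; first exact: fsubset_refl.
move=> T' /fsubsetP NT'; apply: (@le_trans _ _ #|levels|%:R); last first.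
  by apply: levels_tree_length => [|S SF]; apply: NT'; rewrite ?chiN.
rewrite tree_lengthE /= ler_pdivrMr// -natrM -card_nbr.
have tE x y : t x y -> (x == r) && t r y || (y == r) && t r x.
  move=> xy; have := te _ _ xy; rewrite /e /=.
  have [xr|xr] := eqVneq x r; have [yr|yr] := eqVneq y r; rewrite //= => _.
    by rewrite -xr xy.
  by rewrite tr.
pose A := [set q : N * N | t q.1 q.2].
have cA : (#|A| <= #|[set y | t r y]| * 2)%N.
  have sA : A \subset [set (r, y) | y in [set y | t r y]] :|:
      [set (y, r) | y in [set y | t r y]].
    apply/subsetP => -[x y]; rewrite !inE /= => /tE/orP[]/andP[/eqP-> ry];
      apply/orP.
      by left; apply: imset_f; rewrite inE.
    by right; apply: (imset_f (fun y => (y, r))); rewrite inE.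
  apply: leq_trans (subset_leq_card sA) _;
    apply: leq_trans (leq_card_setU _ _) _.
  by rewrite muln2 -addnn leq_add// leq_imset_card.
apply: (@le_trans _ _ #|A|%:R); last by rewrite ler_nat.
rewrite -sumr_const [leRHS](eq_bigl (fun q : N * N => t q.1 q.2));
  last by move=> q; rewrite inE.
apply: ler_sum => -[x y] /= /tE/orP[]/andP[/eqP-> ry].
  by rewrite sub0r normrN; apply: norm_nbr.
by rewrite subr0; apply: norm_nbr.
Qed.

End LowerBound.

Theorem theorem3 (R : realType) (n : nat) (hn : (3 <= n)%N) :
  max_given_degree (MZ R n : normedModType R) 'C(n + 2, (n + 2)./2).
Proof.
split=> [|m [N [T [x [minT _ <-]]]]]; last exact: SMT_degree_le minT.
(* For [k = n./2], [k + 1] is the half of [n + 2], and [3 <= n] gives [0 < k < n]. *)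
have -> : 'C(n + 2, (n + 2)./2) = #|@levels n (n./2)|.
  by rewrite card_levels !addn2.
by apply: levels_star; lia.
Qed.
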